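(* Let $A,B\in\mathbb R[x]$ with $\gcd(A,B)=1$ and $p\in\mathbb R$ with $B(p)\ne0$; let $h$, $D_{l,m}$ and the polynomials $\phi_m\in\mathbb R[u]$ ($m\ge0$) be as in the context. Suppose that $D_{m,m}\neq0$ for all $m\ge h$. Then the family $\{\phi_m\}_{m\ge0}$ is a basis of the real vector space $\mathbb R[u]$.
   Context: $A/B$ is the logarithmic derivative $K'/K$ of a nonvanishing differentiable function $K$ on a real interval. Set $W=B'+A$ and $u=x-p$. Expand $B(x)=\sum_{j=0}^{b}c_ju^j$ and $W(x)=\sum_{j=0}^{w}d_ju^j$, where $b=\deg B$, $w=\deg W$ (if $W=0$ take $w=0$, $d_0=0$), and put $c_j=d_j=0$ for $j$ outside the respective range. Let $h=\max\{b,w+1\}$ and $D_{l,m}=(m-h+1)c_{l-m+h}+d_{l-m+h-1}$. For $0\le m\le h-1$ put $\phi_m(u)=u^m$; for $m\ge h$ put $\phi_m(u)=\sum_{l=m-h}^{m}D_{l,m}u^l$. *)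

(* Defs.v *)
From HB Require Import structures.
From mathcomp Require Import all_boot all_order all_algebra.
From mathcomp Require Import all_classical all_reals all_analysis.
Import Order.TTheory GRing.Theory Num.Theory.
Import numFieldNormedType.Exports.

Set Implicit Arguments.
Unset Strict Implicit.
Unset Printing Implicit Defensive.

Local Open Scope classical_set_scope.
Local Open Scope ring_scope.

(* The limit is taken within I, so that the derivative is one-sided at an
   endpoint belonging to I. *)
Definition has_derivative_on (R : realType) (I : interval R) (K dK : R -> R) :=
  forall x, x \in I ->
    (K y - K x) / (y - x) @[y --> within [set` I] x^'] --> dK x.

Definition is_log_derivative_on (R : realType) (I : interval R)
    (K : R -> R) (A B : {poly R}) : Prop :=
  (forall x, x \in I -> K x != 0) /\
  exists2 dK : R -> R, has_derivative_on I K dK &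
    forall x, x \in I -> B.[x] != 0 /\ A.[x] / B.[x] = dK x / K x.

Definition nondegenerate_itv (R : realType) (I : interval R) : Prop :=
  exists x y : R, [/\ x \in I, y \in I & x < y].

(* degree of a polynomial, with the convention deg 0 = 0 *)
Definition deg (R : realType) (q : {poly R}) : nat := (size q).-1.

(* Coefficient of u ^ j in the expansion of q(x) in powers of u = x - p, i.e.
   in q(u + p); it is 0 for j outside [0, deg q], including j < 0. *)
Definition expansion_coef (R : realType) (p : R) (q : {poly R}) (j : int) : R :=
  match j with
  | Posz n => (q \Po ('X + p%:P))`_n
  | Negz _ => 0
  end.

Definition polyW (R : realType) (A B : {poly R}) : {poly R} := B^`() + A.

Definition hh (R : realType) (A B : {poly R}) : nat :=
  maxn (deg B) (deg (polyW A B)).+1.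

(* The indices are computed in int: j = l - m + h - 1 is -1 when l = m - h. *)
Definition DD (R : realType) (A B : {poly R}) (p : R) (l m : nat) : R :=
  let h := (hh A B)%:Z in
  let c := expansion_coef p B in
  let d := expansion_coef p (polyW A B) in
  (m%:Z - h + 1)%:~R * c (l%:Z - m%:Z + h) + d (l%:Z - m%:Z + h - 1).

(* The variable 'X of these polynomials stands for u = x - p. *)
Definition phi (R : realType) (A B : {poly R}) (p : R) (m : nat) : {poly R} :=
  let h := hh A B in
  if (m < h)%N then 'X^m
  else \sum_(m - h <= l < m.+1) DD A B p l m *: 'X^l.

Definition linearly_independent (F : fieldType) (V : lmodType F) (T : eqType)
    (f : T -> V) : Prop :=
  forall (s : seq T) (a : T -> F), uniq s ->
    \sum_(i <- s) a i *: f i = 0 -> forall i, i \in s -> a i = 0.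

Definition spanning (F : fieldType) (V : lmodType F) (T : eqType)
    (f : T -> V) : Prop :=
  forall v : V, exists (s : seq T) (a : T -> F), v = \sum_(i <- s) a i *: f i.

(* The basis notion of mathcomp's vector library is restricted to finite
   dimension, whence this one. *)
Definition is_basis (F : fieldType) (V : lmodType F) (T : eqType)
    (f : T -> V) : Prop :=
  linearly_independent f /\ spanning f.

(* Main.v *)
(* Each [phi_m] has degree exactly [m]: this is clear for [m < h], and for
   [m >= h] the coefficient of [u ^ m] is [D_{m,m}], which is nonzero. A family
   of polynomials with one member in each degree is a basis. *)
Require Import Defs.
From mathcomp Require Import all_boot all_order all_algebra.
From mathcomp Require Import all_classical all_reals all_analysis.
Import Order.TTheory GRing.Theory Num.Theory.
Import numFieldNormedType.Exports.
Local Open Scope ring_scope.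

Lemma size_coef_neq0 (F : fieldType) (q : {poly F}) (n : nat) :
  size q = n.+1 -> q`_n != 0.
Proof.
move=> szq; have := lead_coef_eq0 q.
by rewrite lead_coefE szq -size_poly_eq0 szq => ->.
Qed.

(** In a vanishing combination, let [j] be the largest index of [s] with a nonzero coefficient. No
    other term reaches degree [j], so the coefficient there is [a j] times the leading coefficient
    of [f j], which cannot vanish. *)
Lemma graded_linearly_independent (F : fieldType) (f : nat -> {poly F}) :
  (forall m, size (f m) = m.+1) -> linearly_independent f.
Proof.
move=> szf s a us sum0 i si; apply/eqP/negP => /negP ai0.
pose P j := (j \in s) && (a j != 0).
have exP : exists j, P j by exists i; rewrite /P si.
have bndP j : P j -> (j <= \max_(k <- s) k)%N.
  by case/andP=> sj _; apply: leq_bigmax_seq.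
case: (ex_maxnP exP bndP) => j /andP[sj aj0] maxj.
have /eqP : (\sum_(k <- s) a k *: f k)`_j = 0 by rewrite sum0 coef0.
rewrite (bigD1_seq j) //= coefD coefZ coef_sum big_seq_cond big1 ?addr0.
  by rewrite mulf_eq0 (negPf aj0) (negPf (size_coef_neq0 _ _ _ (szf j))).
(* A term with [k != j] contributes nothing in degree [j]: either [a k = 0], or maximality of [j]
   forces [k < j]. *)
move=> k /andP[sk kj]; rewrite coefZ; have [->|ak0] := eqVneq (a k) 0.
  by rewrite mul0r.
have lekj : (k <= j)%N by apply: maxj; rewrite /P sk.
by rewrite [_`_j]nth_default ?mulr0 // szf ltn_neqAle kj.
Qed.

Lemma graded_spanning (F : fieldType) (f : nat -> {poly F}) :
  (forall m, size (f m) = m.+1) -> spanning f.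
Proof.
move=> szf v.
suff [a ->] : exists a, v = \sum_(0 <= i < size v) a i *: f i.
  by exists (index_iota 0 (size v)), a.
(* The range of summation becomes a mere bound [n] on the size of [v], which allows induction on [n]
   for all [v]. *)
move: (leqnn (size v)); move: {2 3}(size v) => n.
elim: n v => [|n IHn] v szv.
  exists (fun=> 0); rewrite big_nil.
  by apply/eqP; rewrite -size_poly_eq0 -leqn0.
(* This choice of [c] cancels the coefficient of degree [n], so that [v - c *: f n] has size at most
   [n]. *)
pose c := v`_n / (f n)`_n.
have [|a va] := IHn (v - c *: f n).
  apply/leq_sizeP => k; rewrite leq_eqVlt coefB coefZ => /predU1P[<-|ltnk].
    by rewrite /c divfK ?subrr // (size_coef_neq0 _ _ _ (szf n)).
  rewrite [v`_k]nth_default ?(leq_trans szv) //.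
  by rewrite [_`_k]nth_default ?szf // mulr0 subr0.
exists (fun i => if i == n then c else a i).
rewrite big_nat_recr //= eqxx -[LHS](subrK (c *: f n)) va; congr (_ + _).
by apply: eq_big_nat => i /= /ltn_eqF ->.
Qed.

Lemma size_phi (R : realType) (A B : {poly R}) (p : R) (m : nat) :
  ((hh A B <= m)%N -> DD A B p m m != 0) -> size (phi A B p m) = m.+1.
Proof.
rewrite /phi; case: ltnP => [_ _|_ /(_ isT) Dm0]; first by rewrite size_polyXn.
(* The term [l = m] is split off; it alone fixes the size, since the terms with [l < m] add up to
   size at most [m]. *)
rewrite big_nat_recr ?leq_subr //= addrC size_polyDl size_scale ?size_polyXn //.
rewrite ltnS; apply: leq_trans (size_sum _ _ _) _.
rewrite big_seq_cond; apply/bigmax_leqP_seq => l _ /andP[].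
rewrite mem_index_iota => /andP[_ ltlm] _.
by rewrite (leq_trans (size_scale_leq _ _)) ?size_polyXn.
Qed.

Theorem proposition2p5 (R : realType) (A B : {poly R}) (p : R)
  (I : interval R) (K : R -> R)
  (hI : nondegenerate_itv I)
  (hK : is_log_derivative_on I K A B)
  (hAB : coprimep A B)
  (hp : B.[p] != 0)
  (hD : forall m : nat, (hh A B <= m)%N -> DD A B p m m != 0) :
  is_basis (phi A B p).
Proof.
have szphi m : size (phi A B p m) = m.+1 by apply/size_phi/hD.
by split; [apply: graded_linearly_independent | apply: graded_spanning].
Qed.
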